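(* There exist a Hermitian matrix $B\in M_2(\mathbb C)$ and matrices $W,V\in M_2(\mathbb C)$ with $WW^*=VV^*=I_2$ such that the inequality $$\|W^*BW-V^*BV\|_F^2\le2\|B(W-V)\|_F^2$$ fails. That is, for (signed, not necessarily positive semidefinite) Hermitian $B\in M_N(\mathbb C)$ and $W,V\in M_{N,M}(\mathbb C)$ with $WW^*=VV^*=I_N$, this inequality need not hold, even when $N=M=2$.
   Context: $\|\cdot\|_F$ is the Frobenius (Hilbert–Schmidt) norm. *)

(* Defs.v *)
From mathcomp Require Import all_boot all_order all_algebra.
From mathcomp Require Import complex reals.

Set Implicit Arguments.
Unset Strict Implicit.
Unset Printing Implicit Defensive.

Import Order.TTheory GRing.Theory Num.Theory.

Local Open Scope ring_scope.

(* [Normc.normc] is the complex modulus with values in [R]; the generic norm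
   [`|z|] lives in [R[i]], whose order is only partial. *)
Definition frobenius_norm (R : realType) (m n : nat) (A : 'M[R[i]]_(m, n)) : R :=
  Num.sqrt (\sum_(i < m) \sum_(j < n) Normc.normc (A i j) ^+ 2).

(* Main.v *)
(* Take W = 1, B a Hermitian involution of trace 0 and V the rotation of angle t
   in a plane where B is a reflection.  Since V^* B V = V^-2 B and B^2 = 1, the
   two sides are 8 (sin t)^2 = 8 (1 - cos t) (1 + cos t) and 8 (1 - cos t), so
   the inequality fails as soon as 0 < cos t < 1; the value 3/5 makes all the
   entries rational. *)
Require Import Defs.
From mathcomp Require Import all_boot all_order all_algebra.
From mathcomp Require Import complex reals.
From mathcomp Require Import lra.

Import Order.TTheory GRing.Theory Num.Theory.

Local Open Scope ring_scope.
Local Open Scope sesquilinear_scope.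

(** Squaring cancels both the outer root and the root in each modulus, which leaves polynomial
    arithmetic over [R]. *)
Lemma frobenius_norm_real_sqr (R : realType) (m n : nat) (A : 'M[R]_(m, n)) :
  frobenius_norm (map_mx (real_complex R) A) ^+ 2 =
  \sum_(i < m) \sum_(j < n) A i j ^+ 2.
Proof.
rewrite /frobenius_norm sqr_sqrtr; last first.
  by apply: sumr_ge0 => i _; apply: sumr_ge0 => j _; apply: sqr_ge0.
apply: eq_bigr => i _; apply: eq_bigr => j _.
by rewrite mxE /= expr0n addr0 sqr_sqrtr ?sqr_ge0.
Qed.

Lemma trmxC_real (R : realType) (m n : nat) (A : 'M[R]_(m, n)) :
  (map_mx (real_complex R) A)^t* = map_mx (real_complex R) A^T.
Proof. by apply/matrixP => i j; rewrite !mxE; apply: conjc_real. Qed.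

Definition reflection_mx (R : realType) : 'M[R]_2 :=
  \matrix_(i, j) (if i == j then (-1) ^+ i else 0).

(** Cosine 3/5 and sine 4/5, from the triple 3, 4, 5. *)
Definition rotation_mx (R : realType) : 'M[R]_2 :=
  \matrix_(i, j) (if i == j then 3 / 5 else (-1) ^+ i * (4 / 5)).

Lemma rotation_mx_orthogonal (R : realType) :
  rotation_mx R *m (rotation_mx R)^T = 1%:M.
Proof.
apply/matrixP => -[[|[|//]] ?] [[|[|//]] ?];
  rewrite !mxE !big_ord_recl big_ord0 !mxE /=; lra.
Qed.

Theorem proposition9p1 (R : realType) :
  exists B W V : 'M[R[i]]_2,
    [/\ B \is hermsymmx,
        W *m W^t* = 1%:M,
        V *m V^t* = 1%:M
      & ~ (frobenius_norm (W^t* *m B *m W - V^t* *m B *m V) ^+ 2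
           <= 2 * frobenius_norm (B *m (W - V)) ^+ 2)].
Proof.
pose C := map_mx (real_complex R) : 'M[R]_2 -> 'M[R[i]]_2.
exists (C (reflection_mx R)), (C 1%:M), (C (rotation_mx R)); split.
(* The sign of the form is [(-1) ^+ 0], so real symmetry of the matrix suffices. *)
- apply/is_hermitianmxP; rewrite expr0 scale1r trmxC_real; congr map_mx.
  by apply/matrixP => i j; rewrite !mxE eq_sym; case: eqP => // ->.
- by rewrite trmxC_real -map_mxM trmx1 mulmx1 map_mx1.
- by rewrite trmxC_real -map_mxM rotation_mx_orthogonal map_mx1.
rewrite !trmxC_real -!map_mxM -!map_mxB -map_mxM !frobenius_norm_real_sqr.
rewrite trmx1 mul1mx mulmx1.
rewrite !big_ord_recl !big_ord0 !mxE !big_ord_recl !big_ord0 !mxE.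
rewrite !big_ord_recl !big_ord0 !mxE /=.
(* With the exponents of -1 computed, the claim is 16/5 < 128/25. *)
apply/negP; rewrite -ltNge /bump /= !expr0 ?expr1.
lra.
Qed.
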